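(* Let $S=\mathbb{K}[x_1,\dots,x_n]$ be a polynomial ring over a field $\mathbb{K}$, and let $\mathcal{C}$ be a clutter whose vertex set is a subset of $\{x_1,\dots,x_n\}$, with edge ideal $I(\mathcal{C})\subset S$. Then \[ \min\{\operatorname{depth}(S/I(\mathcal{C})),\ \operatorname{sdepth}(S/I(\mathcal{C}))\}\ge \epsilon(\mathcal{C})+n-|V(\mathcal{C}^{\mathrm{red}})|. \]
   Context: A clutter $\mathcal{C}$ consists of a finite vertex set $V(\mathcal{C})$ and a collection $E(\mathcal{C})$ of subsets of $V(\mathcal{C})$ (edges), no edge containing another. Vertices are identified with variables; the edge ideal is $I(\mathcal{C})=(\prod_{x\in e}x : e\in E(\mathcal{C}))$. Two distinct vertices are neighbors if some edge contains both. A vertex is isolated if it lies in no edge; $\mathcal{C}^{\mathrm{red}}$ is the clutter obtained by removing isolated vertices. An edge is trivial if it has exactly one vertex. A set $F\subseteq E(\mathcal{C})$ of edges is edgewise dominant if every vertex $v\in V(\mathcal{C}^{\mathrm{red}})$ that is neither contained in an edge of $F$ nor contained in a trivial edge has a neighbor contained in some edge of $F$. The index of edgewise domination is $\epsilon(\mathcal{C})=\min\{|F| : F\subseteq E(\mathcal{C}) \text{ edgewise dominant}\}$. For a finitely generated $\mathbb{Z}^n$-graded $S$-module $M$, a Stanley decomposition is a finite direct sum decomposition $M=\bigoplus_{i=1}^r u_i\mathbb{K}[Z_i]$ of $\mathbb{K}$-vector spaces, with $u_i\in M$ homogeneous, $Z_i\subseteq\{x_1,\dots,x_n\}$, and $u_i\mathbb{K}[Z_i]$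 the $\mathbb{K}$-span of $u_iv$ for monomials $v\in\mathbb{K}[Z_i]$ (required to be a free $\mathbb{K}[Z_i]$-module); its Stanley depth is $\min_i|Z_i|$, and $\operatorname{sdepth}(M)$ is the maximum of this over all Stanley decompositions of $M$. *)

(* Defs.v *)
From HB Require Import structures.
From mathcomp Require Import all_boot all_order all_algebra.
From mathcomp Require Import mpoly.
Set Implicit Arguments. Unset Strict Implicit. Unset Printing Implicit Defensive.
Import GRing.Theory.
Local Open Scope ring_scope.

(* Variables x_1..x_n are indexed by 'I_n: vertex i <-> variable 'X_i. *)

Section Clutter.
Variable n : nat.
Implicit Types (V e : {set 'I_n}) (E F : {set {set 'I_n}}).

Definition clutter V E : Prop :=
  (forall e, e \in E -> e \subset V) /\
  (forall e, e \in E -> e != set0) /\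
  (forall e1 e2, e1 \in E -> e2 \in E -> e1 \subset e2 -> e1 = e2).

Definition Vred E : {set 'I_n} := \bigcup_(e in E) e.

Definition neighbors E (u v : 'I_n) : bool :=
  (u != v) && [exists e in E, (u \in e) && (v \in e)].

Definition has_trivial_edge E (v : 'I_n) : bool := [set v] \in E.

Definition edgewise_dominant E F : bool :=
  (F \subset E) &&
  [forall v, ((v \in Vred E) && (v \notin \bigcup_(f in F) f)
               && ~~ has_trivial_edge E v) ==>
             [exists u, neighbors E u v && (u \in \bigcup_(f in F) f)]].

(* epsilon(C): minimal size of an edgewise dominant set of edges
   (E itself is always edgewise dominant, so the arg min is well defined). *)
Definition eps E : nat :=
  #|[arg min_(F < E | edgewise_dominant E F) #|F|]|.

End Clutter.

Section Algebra.
Variables (K : fieldType) (n : nat).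
Local Notation S := {mpoly K[n]}.

Definition edge_mon (e : {set 'I_n}) : S := \prod_(i in e) 'X_i.

Definition edge_gens (E : {set {set 'I_n}}) : seq S :=
  [seq edge_mon e | e <- enum E].

Definition in_ideal (gens : seq S) (f : S) : Prop :=
  exists c : 'I_(size gens) -> S, f = \sum_(i < size gens) c i * gens`_i.

Definition in_max_ideal (f : S) : Prop := f@_0%MM = 0.

Definition regular_seq (gens fs : seq S) : Prop :=
  (forall j, (j < size fs)%N -> in_max_ideal fs`_j) /\
  (forall j, (j < size fs)%N -> forall g : S,
       in_ideal (gens ++ take j fs) (fs`_j * g) ->
       in_ideal (gens ++ take j fs) g) /\
  ~ in_ideal (gens ++ fs) 1.

Definition depth_ge (gens : seq S) (k : nat) : Prop :=
  exists fs : seq S, size fs = k /\ regular_seq gens fs.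

Definition in_KZ (Z : {set 'I_n}) (p : S) : Prop :=
  forall m : 'X_{1..n}, p@_m != 0 -> forall i, i \notin Z -> m i = 0%N.

(* Stanley decomposition S/I = (+)_i u_i K[Z_i] of the Z^n-graded module
   S/I, I = (gens).  u_i is represented by a Z^n-homogeneous polynomial
   c * x^a; u_i K[Z_i] is a free K[Z_i]-module (p |-> u_i p injective
   into S/I); the sum is direct and equals S/I. *)
Definition stanley_dec (gens : seq S) (D : seq (S * {set 'I_n})) : Prop :=
  let r := size D in
  let u i := (nth (0%R : {mpoly K[n]}, set0) D i).1 in
  let Z i := (nth (0%R : {mpoly K[n]}, set0) D i).2 in
  (forall i, (i < r)%N -> exists (c : K) (a : 'X_{1..n}), u i = c *: 'X_[a]) /\
  (forall i, (i < r)%N -> forall p : S, in_KZ (Z i) p ->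
       in_ideal gens (u i * p) -> p = 0) /\
  (forall f : S, exists ps : seq S, size ps = r /\
       (forall i, (i < r)%N -> in_KZ (Z i) ps`_i) /\
       in_ideal gens (f - \sum_(i < r) u i * ps`_i)) /\
  (forall ps : seq S, size ps = r ->
       (forall i, (i < r)%N -> in_KZ (Z i) ps`_i) ->
       in_ideal gens (\sum_(i < r) u i * ps`_i) ->
       forall i, (i < r)%N -> in_ideal gens (u i * ps`_i)).

Definition sdepth_ge (gens : seq S) (k : nat) : Prop :=
  exists D : seq (S * {set 'I_n}), stanley_dec gens D /\
    (forall i, (i < size D)%N -> (k <= #|(nth (0%R : {mpoly K[n]}, set0) D i).2|)%N).

End Algebra.

(* Main.v *)
(* For a variable x and a monomial ideal I, the module S/I is an extension of S/(I, x)
   by a shifted copy of S/(I : x).  Hence a tree of colon and plus steps whose leaves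
   are S or ideals (x_i : i in A) with k + #|A| <= n bounds both invariants by k.  For
   sdepth, glue the decompositions.  For depth without homological algebra, use that
   the elementary symmetric polynomials e_1, ..., e_k form a regular sequence on all
   the leaves at once, hence on every extension of them.

   To grow the tree, pick a vertex y lying in no trivial edge and kill its neighbours
   x one at a time, until y is isolated.  Each subtree hanging off this path (the
   ideals colon x, and the last ideal) comes from a set of edges D with fewer
   non-isolated vertices, to which induction applies: a dominant set of D, enlarged to
   edges of E, dominates E after adding one edge for each vertex that became isolated. *)

Require Import Defs.
From HB Require Import structures.
From mathcomp Require Import all_boot all_order all_algebra.
From mathcomp Require Import mpoly zify ring.

Set Implicit Arguments.
Unset Strict Implicit.
Unset Printing Implicit Defensive.

Import GRing.Theory.


(** * Edgewise domination and the loss of a vertex *)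

Section Domination.

Variable n : nat.
Implicit Types (E F D : {set {set 'I_n}}) (d e X A : {set 'I_n}) (u v w x y z : 'I_n)
  (m : 'X_{1..n}) (P : pred 'X_{1..n}).

Lemma mem_Vred E v : reflect (exists2 e, e \in E & v \in e) (v \in Vred E).
Proof. exact: bigcupP. Qed.

Lemma edgewise_dominantP E F :
  reflect (F \subset E /\ forall v, v \in Vred E -> v \notin Vred F ->
             [set v] \notin E -> exists2 u, neighbors E u v & u \in Vred F)
          (edgewise_dominant E F).
Proof.
apply: (iffP andP) => -[sFE].
  move=> /forallP dom; split=> // v vE vF v_nt.
  have /implyP := dom v; rewrite vE vF /has_trivial_edge v_nt.
  by case/(_ isT)/existsP=> u /andP[]; exists u.
move=> dom; split=> //; apply/forallP=> v; apply/implyP.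
case/andP=> /andP[vE vF] v_nt; have [u uv uF] := dom v vE vF v_nt.
by apply/existsP; exists u; rewrite uv.
Qed.

Lemma edgewise_dominant_self E : edgewise_dominant E E.
Proof. by apply/edgewise_dominantP; split=> // v ->. Qed.

Lemma eps_leq E F : edgewise_dominant E F -> eps E <= #|F|.
Proof.
move=> domF; rewrite /eps; case: arg_minnP; last by move=> F0 _ /(_ F domF).
exact: edgewise_dominant_self.
Qed.

Lemma eps_attained E : exists2 F, edgewise_dominant E F & #|F| = eps E.
Proof.
rewrite /eps; case: arg_minnP; first exact: edgewise_dominant_self.
by move=> F domF _; exists F.
Qed.

(* [D] is obtained from [E] by a deletion or a contraction in which [z] is lost: the edge
   [e] pays for [z], and takes care of the vertices which [D] need not dominate because
   they have become trivial. *)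
Lemma leq_eps_lost_vertex E D e z :
    (forall d, d \in D -> exists2 e', e' \in E & d \subset e') ->
    e \in E -> z \in e -> z \notin Vred D ->
    (forall w, [set w] \in D ->
       [\/ [set w] \in E, w \in e | exists2 u, neighbors E u w & u \in e]) ->
  eps E + #|Vred D| <= eps D + #|Vred E|.
Proof.
move=> inflate eE ze zD new_trivial.
(* [sup d] is some edge of [E] containing [d]. The default [set0] is never reached below: [sup] is
   applied to edges of [D] and to singletons of vertices of [Vred E]. *)
pose sup d := odflt set0 [pick e' in E | d \subset e'].
have supP d : (exists2 e', e' \in E & d \subset e') -> sup d \in E /\ d \subset sup d.
  by rewrite /sup => -[e' e'E de']; case: pickP => [? /andP[]|/(_ e')] //=; rewrite e'E de'.
have zE : z \in Vred E by apply/mem_Vred; exists e.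
have sub_Vred : Vred D \subset Vred E.
  apply/subsetP=> v /mem_Vred[d dD vd]; have [e' e'E /subsetP de'] := inflate d dD.
  by apply/mem_Vred; exists e' => //; apply: de'.
have [F' domF' cardF'] := eps_attained D.
have /edgewise_dominantP[/subsetP sF'D domD] := domF'.
pose L := (Vred E :\: Vred D) :\ z.
(* Three kinds of edges: the enlarged edges of [F'], the edge [e] paying for [z], and one edge for
   each further lost vertex. The last two number at most [1 + #|L|], the drop from [#|Vred E|] to
   [#|Vred D|]. *)
pose F := (sup @: F') :|: (e |: (fun v => sup [set v]) @: L).
have cardF : #|F| <= eps D + (#|Vred E| - #|Vred D|).
  have -> : #|Vred E| - #|Vred D| = 1 + #|L|.
    by rewrite -(setIidPr sub_Vred) -cardsD (cardsD1 z) inE zD zE.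
  rewrite -cardF'; apply: leq_trans (leq_card_setU _ _) _.
  apply: leq_add; first exact: leq_imset_card.
  by apply: leq_trans (leq_card_setU _ _) _; rewrite cards1 leq_add2l leq_imset_card.
have sup1P v : v \in Vred E -> sup [set v] \in E /\ v \in sup [set v].
  case/mem_Vred=> e' e'E ve'; rewrite -[v \in _]sub1set; apply: supP.
  by exists e'; rewrite ?sub1set.
have covered_e w : w \in e -> w \in Vred F.
  by move=> we; apply/mem_Vred; exists e; rewrite ?inE ?eqxx ?orbT.
have covered_lost v : v \in Vred E -> v \notin Vred D -> v \in Vred F.
  move=> vE vD; have [->|v_z] := eqVneq v z; first exact: covered_e.
  have [_ v_sup] := sup1P v vE.
  apply/mem_Vred; exists (sup [set v]) => //; rewrite !inE; apply/orP; right.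
  by apply/orP; right; apply: imset_f; rewrite !inE v_z vD vE.
have covered_F' v : v \in Vred F' -> v \in Vred F.
  case/mem_Vred=> d dF' vd; have [_ /subsetP dsup] := supP d (inflate d (sF'D d dF')).
  by apply/mem_Vred; exists (sup d); rewrite ?inE ?imset_f //; apply: dsup.
suff domF : edgewise_dominant E F.
  move: (subset_leq_card sub_Vred) (leq_trans (eps_leq domF) cardF).
  by move: #|Vred E| #|Vred D| => a b; lia.
apply/edgewise_dominantP; split.
  apply/subsetP=> f; rewrite !inE => /or3P[/imsetP[d dF' ->]|/eqP->//|/imsetP[v]].
    by have [] := supP d (inflate d (sF'D d dF')).
  by rewrite !inE => /and3P[_ _ vE] ->; have [] := sup1P v vE.
move=> v vE vF v_nt; have [vD|vD] := boolP (v \in Vred D); last first.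
  by rewrite covered_lost in vF.
have [v_tD|v_ntD] := boolP ([set v] \in D).
  case: (new_trivial v v_tD) => [vtE|ve|[u uv ue]].
  - by rewrite vtE in v_nt.
  - by rewrite covered_e in vF.
  - by exists u => //; apply: covered_e.
(* A neighbour in [D] is a neighbour in [E], since an edge of [D] lies in one of [E]. *)
have [|u] := domD v vD _ v_ntD; first by apply: contra vF; apply: covered_F'.
case/andP=> u_v /exists_inP[d dD /andP[ud vd]] uF'.
exists u; last exact: covered_F'.
have [e' e'E /subsetP de'] := inflate d dD.
by rewrite /neighbors u_v; apply/exists_inP; exists e' => //; rewrite !de'.
Qed.

(** * The tree of colon and plus steps of an edge ideal *)

Definition mon_in E (m : 'X_{1..n}) := [exists e in E, [forall i in e, 0 < m i]].

Lemma mon_inP E m :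
  reflect (exists2 e, e \in E & forall i, i \in e -> 0 < m i) (mon_in E m).
Proof.
by apply: (iffP exists_inP) => -[e eE em]; exists e => //; apply/forall_inP.
Qed.

(* Monomial ideals are given by the predicate selecting their monomials. *)
Inductive depth_tree (k : nat) : pred 'X_{1..n} -> Prop :=
| DepthUnit P of (forall m, P m) : depth_tree k P
| DepthVars P A of (forall m, P m = [exists i in A, 0 < m i]) & k + #|A| <= n :
    depth_tree k P
| DepthNode P (Pcolon Pplus : pred 'X_{1..n}) i of
    (forall m, Pcolon m = P (m + U_(i))%MM) &
    (forall m, Pplus m = P m || (0 < m i)) &
    depth_tree k Pcolon & depth_tree k Pplus : depth_tree k P.

Lemma depth_tree_leq k k' P : k' <= k -> depth_tree k P -> depth_tree k' P.
Proof.
move=> le_k; elim=> {P} [P PT|P A PA leA|P Pc Pp i Pc_def Pp_def _ IHc _ IHp].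
- exact: DepthUnit.
- by apply: DepthVars PA _; apply: leq_trans leA; rewrite leq_add2r.
- exact: DepthNode Pc_def Pp_def IHc IHp.
Qed.

(* Generators of [I + (x : x in X)], with the redundant edges meeting [X] discarded. *)
Definition kill_vars E X := [set e in E | [disjoint e & X]] :|: [set [set x] | x in X].

(* Generators of [I : x], possibly not minimal and then not a clutter: the induction
   runs over arbitrary sets of edges. *)
Definition colon_edges E x := [set e :\ x | e in E].

Lemma kill_varsP E X d :
  reflect ((d \in E /\ [disjoint d & X]) \/ exists2 x, x \in X & d = [set x])
          (d \in kill_vars E X).
Proof.
rewrite !inE; apply: (iffP orP) => -[/andP|]; try by left.
- by case/imsetP=> x; right; exists x.
- by case=> x xX ->; right; apply: imset_f.
Qed.

Lemma mon_in_kill_var E X x m :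
  mon_in (kill_vars E (x |: X)) m = mon_in (kill_vars E X) m || (0 < m x).
Proof.
apply/mon_inP/orP => [[d /kill_varsP[[dE dX]|[w wX ->]] dm]|[/mon_inP[d]|mx]].
- left; apply/mon_inP; exists d => //; apply/kill_varsP; left; split=> //.
  by apply: disjointWr dX; apply: subsetUr.
- have mw : 0 < m w by apply: dm; rewrite inE.
  case/setU1P: wX => [<-|wX]; [by right|left].
  by apply/mon_inP; exists [set w] => //; apply/kill_varsP; right; exists w.
- case/kill_varsP=> [[dE dX]|[w wX ->]] dm.
    (* An edge through [x] is discarded from the new family, but [[set x]] divides it. *)
    have [xd|xd] := boolP (x \in d).
      exists [set x]; first by apply/kill_varsP; right; exists x; rewrite ?setU11.
      by move=> i /set1P->; apply: dm.
    exists d => //; apply/kill_varsP; left; split=> //.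
    by rewrite disjoint_sym disjoints_subset subUset sub1set inE xd -disjoints_subset disjoint_sym.
  by exists [set w] => //; apply/kill_varsP; right; exists w; rewrite // inE wX orbT.
- exists [set x]; first by apply/kill_varsP; right; exists x; rewrite ?setU11.
  by move=> i /set1P->.
Qed.

Lemma mon_in_colon E x m : mon_in (colon_edges E x) m = mon_in E (m + U_(x))%MM.
Proof.
apply/mon_inP/mon_inP => [[_ /imsetP[e eE ->] em]|[e eE em]].
  exists e => // i ie; rewrite mnmDE mnm1E; case: eqVneq => [|x_i]; first by rewrite addn1.
  by rewrite addn0; apply: em; rewrite !inE eq_sym x_i.
exists (e :\ x); first exact: imset_f.
move=> i /setD1P[x_i ie]; have := em i ie.
by rewrite mnmDE mnm1E eq_sym (negPf x_i) addn0.
Qed.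

Lemma kill_vars0 E : kill_vars E set0 = E.
Proof.
apply/setP=> d; apply/kill_varsP/idP => [[[]|[x]]|dE] //; first by rewrite inE.
by left; rewrite disjoint_sym disjoints_subset sub0set.
Qed.

Theorem depth_tree_edges E : depth_tree (eps E + n - #|Vred E|) (mon_in E).
Proof.
have [N] := ubnP #|Vred E|; elim: N E => // N IH E; rewrite ltnS => leN.
(* The colon by [x] turns an edge [[set x]] into the empty one, so the unit ideal may occur in the
   induction. *)
have [E0|E0] := boolP (set0 \in E).
  by apply: DepthUnit => m; apply/mon_inP; exists set0 => // i; rewrite inE.
have leVn D : #|Vred D| <= n by rewrite -[leqRHS]card_ord max_card.
have [y /andP[/= yE y_nt]|all_trivial] := pickP [pred y in Vred E | [set y] \notin E]; last first.
  (* Here the ideal is generated by the variables in [Vred E], and the empty family is dominant, so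
     [eps E] is 0 and the bound to reach is [n - #|Vred E|]. *)
  have trivE v : v \in Vred E -> [set v] \in E.
    by move=> vE; have /= := all_trivial v; rewrite vE /= => /negbFE.
  apply: (@DepthVars _ _ (Vred E)) => [m|].
    apply/mon_inP/exists_inP => [[e eE em]|[v vE mv]].
      have [e0|[v ve]] := set_0Vmem e; first by rewrite -e0 eE in E0.
      by exists v; [apply/mem_Vred; exists e | apply: em].
    by exists [set v]; [apply: trivE | move=> i /set1P->].
  have : eps E <= #|@set0 {set 'I_n}|.
    apply/eps_leq/edgewise_dominantP; split=> [|v vE _]; first exact: sub0set.
    by rewrite trivE.
  by rewrite cards0; have := leVn E; lia.
pose Nb := [set x | neighbors E x y].
suff main X : X \subset Nb ->
    depth_tree (eps E + n - #|Vred E|) (mon_in (kill_vars E X)).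
  by have := main _ (sub0set _); rewrite kill_vars0.
(* Inner induction on the number of neighbours of [y] not yet killed. *)
have [c] := ubnP #|Nb :\: X|; elim: c X => // c IHc X; rewrite ltnS => leX sXN.
have X_y x : x \in X -> neighbors E x y by move/(subsetP sXN); rewrite inE.
have yX : y \notin X by apply/negP=> /X_y; rewrite /neighbors eqxx.
have inflate d : d \in kill_vars E X -> exists2 e, e \in E & d \subset e.
  case/kill_varsP=> [[dE _]|[x /X_y /andP[_ /exists_inP[e eE /andP[xe _]]] ->]].
    by exists d.
  by exists e; rewrite ?sub1set.
(* A killed variable may have become trivial without being so in [E], but it is a neighbour of [y],
   which lies in [e]. *)
have trivial_dominated e w : y \in e -> e \in E -> [set w] \in kill_vars E X ->
    [\/ [set w] \in E, w \in e | exists2 u, neighbors E u w & u \in e].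
  move=> ye eE /kill_varsP[[wE _]|[x xX /set1_inj->]]; first by apply: Or31.
  apply: Or33; exists y => //; have /andP[x_y /exists_inP[e' e'E /andP[xe' ye']]] := X_y x xX.
  by rewrite /neighbors eq_sym x_y; apply/exists_inP; exists e'; rewrite ?ye'.
(* Closes a subtree by the outer induction: the loss of [z] makes [Vred D] smaller, and the bound
   for [D] is at least the one for [E]. *)
have close D e z : (forall d, d \in D -> exists2 e', e' \in E & d \subset e') ->
    e \in E -> z \in e -> z \notin Vred D ->
    (forall w, [set w] \in D ->
       [\/ [set w] \in E, w \in e | exists2 u, neighbors E u w & u \in e]) ->
    depth_tree (eps E + n - #|Vred E|) (mon_in D).
  move=> inflD eE ze zD trivD.
  have le_eps := leq_eps_lost_vertex inflD eE ze zD trivD.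
  apply: (@depth_tree_leq (eps D + n - #|Vred D|)); first by have := leVn E; lia.
  apply: IH; apply: leq_trans leN; apply: proper_card; apply/properP; split.
    apply/subsetP=> v /mem_Vred[d dD vd]; have [e' e'E /subsetP de'] := inflD d dD.
    by apply/mem_Vred; exists e'; rewrite ?de'.
  by exists z => //; apply/mem_Vred; exists e.
have [/mem_Vred[g gD yg]|yD] := boolP (y \in Vred (kill_vars E X)); last first.
  have /mem_Vred[e eE ye] := yE.
  by apply: (close _ e y) => // w; apply: trivial_dominated.
have [gE gX] : g \in E /\ [disjoint g & X].
  by case/kill_varsP: gD => // -[x xX g_x]; move: yg yX; rewrite g_x => /set1P->; rewrite xX.
(* The surviving edge [g] is not [[set y]], since [y] lies in no trivial edge; any other vertex of
   [g] is the next neighbour to kill. *)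
have [x xg x_y] : exists2 x, x \in g & x != y.
  have [g_y|/set0Pn[x /setD1P[x_y xg]]] := eqVneq (g :\ y) set0; last by exists x.
  by case/negP: y_nt; rewrite -(setD1K yg) g_y setU0 in gE.
have x_nX : x \notin X by rewrite (disjointFr gX xg).
have xN : x \in Nb by rewrite inE /neighbors x_y; apply/exists_inP; exists g; rewrite ?xg.
apply: (@DepthNode _ _ _ _ x (mon_in_colon _ x) (mon_in_kill_var E X x)); last first.
  apply: IHc; last by rewrite subUset sub1set xN.
  apply: leq_trans leX; apply: proper_card; apply/properP; split.
    by apply: setDS; apply: subsetUr.
  by exists x; rewrite !inE ?eqxx // x_nX; rewrite inE in xN.
apply: (close _ g x) => // [_ /imsetP[d /inflate[e eE de] ->]||w /imsetP[d dD w_d]].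
- by exists e => //; apply: subset_trans de; apply: subsetDl.
- by apply/mem_Vred=> -[_ /imsetP[d _ ->]]; rewrite !inE eqxx.
(* A trivial edge of the colon either was trivial before it, or comes from an edge with vertices [x]
   and [w], and then [x], which lies in [g], is a neighbour of [w]. *)
have [xd|xd] := boolP (x \in d); last first.
  by apply: trivial_dominated => //; rewrite w_d (setDidPl _) // disjoint_sym disjoints1.
case/kill_varsP: dD => [[dE _]|[v vX d_v]]; last first.
  by move: xd x_nX; rewrite d_v => /set1P->; rewrite vX.
have /setD1P[w_x wd] : w \in d :\ x by rewrite -w_d set11.
apply: Or33; exists x => //; rewrite /neighbors eq_sym w_x.
by apply/exists_inP; exists d; rewrite ?xd.
Qed.

End Domination.


(** * Monomial ideals and Stanley decompositions *)

Section MonomialIdeals.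

Variables (K : fieldType) (n : nat).
Local Notation S := {mpoly K[n]}.
Local Open Scope ring_scope.
Implicit Types (J : S -> Prop) (f g h : S) (gens fs : seq S) (P : pred 'X_{1..n})
  (b : 'X_{1..n} * {set 'I_n}).

Definition ideal J :=
  [/\ J 0, forall f g, J f -> J g -> J (f + g) & forall h f, J f -> J (h * f)].

Lemma idealB J f g : ideal J -> J f -> J g -> J (f - g).
Proof. by case=> _ JD JM Jf Jg; apply: JD => //; rewrite -mulN1r; apply: JM. Qed.

Lemma ideal_sum J (I : Type) (r : seq I) (Q : pred I) (F : I -> S) :
  ideal J -> (forall i, Q i -> J (F i)) -> J (\sum_(i <- r | Q i) F i).
Proof. by case=> J0 JD _; apply: big_ind. Qed.

Lemma in_ideal_ideal gens : ideal (in_ideal gens).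
Proof.
split=> [|f g [c ->] [d ->]|h f [c ->]].
- by exists (fun=> 0); rewrite big1 // => i _; rewrite mul0r.
- by exists (fun i => c i + d i); rewrite -big_split; apply: eq_bigr => i _; rewrite mulrDl.
- by exists (fun i => h * c i); rewrite mulr_sumr; apply: eq_bigr => i _; rewrite mulrA.
Qed.

Lemma in_ideal_gen gens f : f \in gens -> in_ideal gens f.
Proof.
move=> f_gens; have f_lt : (index f gens < size gens)%N by rewrite index_mem.
exists (fun i => (i == Ordinal f_lt)%:R).
rewrite (bigD1 (Ordinal f_lt)) //= eqxx mul1r nth_index // big1 ?addr0 //.
by move=> i /negPf->; rewrite mul0r.
Qed.

Lemma in_ideal_min J gens f :
  ideal J -> (forall g, g \in gens -> J g) -> in_ideal gens f -> J f.
Proof.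
move=> idJ Jgens [c ->]; apply: ideal_sum => // i _.
by case: idJ => _ _; apply; apply: Jgens; apply: mem_nth.
Qed.

Definition mon_ideal P f := forall m, f@_m != 0 -> P m.

Definition up_closed P := forall m m', P m -> P (m + m')%MM.

Lemma mon_in_up E : up_closed (mon_in E).
Proof.
move=> m m' /mon_inP[e eE em]; apply/mon_inP; exists e => // i ie.
by rewrite mnmDE addn_gt0 em.
Qed.

Lemma mcoeffXM p a m :
  ('X_[a] * p : S)@_m = if (a <= m)%MM then p@_(m - a)%MM else 0.
Proof.
rewrite mulrC; case: ifPn => [/submK {1}<-|le_am]; first by rewrite addmC mcoeffMX.
apply/eqP; rewrite mcoeff_eq0 (perm_mem (msuppMX _ _)).
by apply: contra le_am => /mapP[m' _ ->]; rewrite lem_addr.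
Qed.

Lemma mon_ideal_ideal P : up_closed P -> ideal (mon_ideal P).
Proof.
move=> upP; split=> [m|f g Pf Pg m|h f Pf m]; first by rewrite mcoeff0 eqxx.
  by rewrite mcoeffD; have [->|/Pf] := eqVneq f@_m 0; rewrite ?add0r //; apply: Pg.
rewrite -mcoeff_msupp => /msuppM_le/allpairsP[[m1 m2] /= [_]].
by rewrite mcoeff_msupp => /Pf P2 ->; rewrite addmC; apply: upP.
Qed.

(** The passage from generators to exponents: [edge_mon K e] is the single monomial of exponent
    [mesym1 e], and it divides ['X_[m]] exactly when [m] is positive on [e]. *)
Lemma in_ideal_edges E f : in_ideal (edge_gens K E) f <-> mon_ideal (mon_in E) f.
Proof.
have edge_monE e : edge_mon K e = 'X_[mesym1 e].
  rewrite /edge_mon mprodXE; congr 'X_[_]; apply/mnmP=> i.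
  rewrite mnmE mnm_sumE big_mkcond (bigD1 i) //= mnm1E eqxx big1 ?addn0; last first.
    by move=> j j_i; case: ifP => // _; rewrite mnm1E (negPf j_i).
  by case: (i \in e).
split=> [|Ef].
  apply: in_ideal_min; first exact/mon_ideal_ideal/mon_in_up.
  move=> _ /mapP[e eE ->] m; rewrite edge_monE mcoeffX.
  have [<- _|_] := eqVneq (mesym1 e) m; last by rewrite eqxx.
  by rewrite mem_enum in eE; apply/mon_inP; exists e => // i ie; rewrite mnmE ie.
have idE := in_ideal_ideal (edge_gens K E).
rewrite [f]mpolyE big_seq; apply: ideal_sum => // m.
rewrite mcoeff_msupp => /Ef/mon_inP[e eE em].
have le_em : (mesym1 e <= m)%MM.
  by apply/mnm_lepP=> i; rewrite mnmE; case: (boolP (i \in e)) => [/em|].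
rewrite -(submK le_em) mpolyXD -edge_monE -mul_mpolyC mulrA.
by case: idE => _ _; apply; apply/in_ideal_gen/map_f; rewrite mem_enum.
Qed.

(* The monomials of the Stanley space [x^b.1 K[b.2]]. *)
Definition in_box b (m : 'X_{1..n}) :=
  [forall i, (b.1 i <= m i)%N && ((i \notin b.2) ==> (m i == b.1 i))].

Lemma in_boxP b m :
  reflect ((b.1 <= m)%MM /\ forall i, i \notin b.2 -> m i = b.1 i) (in_box b m).
Proof.
apply: (iffP forallP) => [box|[/mnm_lepP le_bm eq_bm] i].
  split=> [|i ib]; first by apply/mnm_lepP=> i; case/andP: (box i).
  by have /andP[_ /implyP/(_ ib)/eqP] := box i.
by rewrite le_bm; apply/implyP => /eq_bm->.
Qed.

(** Counting states covering and disjointness at once: the boxes partition the monomials outside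
    [P]. *)
Lemma depth_tree_boxes k P : depth_tree k P ->
  exists2 B : seq ('X_{1..n} * {set 'I_n}),
    {in B, forall b, (k <= #|b.2|)%N} & forall m, count (in_box^~ m) B = ~~ P m.
Proof.
elim=> {P} [P PT|P A PA leA|P Pc Pp i Pc_def Pp_def _ [B1 geB1 countB1] _ [B2 geB2 countB2]].
- by exists [::] => // m; rewrite PT.
- exists [:: (0%MM, ~: A)] => [b|m].
    by rewrite inE => /eqP-> /=; rewrite cardsCs setCK card_ord leq_subRL; lia.
  rewrite /= addn0; congr nat_of_bool; rewrite PA negb_exists.
  apply: eq_forallb => j; rewrite mnm0E inE negbK leq0n /= negb_and -eqn0Ngt.
  by case: (j \in A).
(* Outside [P], the monomials not divisible by ['X_i] are those outside [Pplus]; the divisible ones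
   are ['X_i] times those outside [Pcolon], whence the shift. *)
exists ([seq (b.1 + U_(i), b.2)%MM | b <- B1] ++ B2) => [b|m].
  rewrite mem_cat => /orP[/mapP[b1 /geB1 ge_b1 ->]|/geB2] //.
rewrite count_cat count_map countB2 Pp_def.
have [mi0|mi_gt0] := posnP (m i).
  rewrite orbF; rewrite -[RHS]add0n; congr addn.
  rewrite -(count_pred0 B1); apply: eq_count => b /=; apply/negbTE/negP.
  by case/in_boxP => /mnm_lepP/(_ i); rewrite mi0 mnmDE mnm1E eqxx addn1.
have le_im : (U_(i) <= m)%MM by rewrite lep1mP -lt0n.
rewrite orbT addn0 -{2}(submK le_im) -Pc_def -countB1; apply: eq_count => b /=.
apply: eq_forallb => j /=; rewrite mnmDE mnmBE.
move: (U_(i)%MM j) (mnm_lepP le_im j) => c le_cm; rewrite leq_subRL // addnC.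
by congr (_ && (_ ==> _)); apply/eqP/eqP; lia.
Qed.

Lemma mcoeff_restrict f (Q : pred 'X_{1..n}) m :
  (\sum_(m' <- msupp f | Q m') f@_m' *: 'X_[m'])@_m = if Q m then f@_m else 0.
Proof.
rewrite raddf_sum /=; have [mf|mf] := boolP (m \in msupp f); last first.
  rewrite (memN_msupp_eq0 mf) if_same big_seq_cond big1 // => m' /andP[m'f _].
  rewrite mcoeffZ mcoeffX; case: eqVneq => [m'm|_]; last by rewrite mulr0.
  by rewrite m'm (negPf mf) in m'f.
rewrite big_mkcond (bigD1_seq m) ?msupp_uniq //= mcoeffZ mcoeffX eqxx mulr1.
rewrite big1 ?addr0 // => m' m'_m; case: ifP => // _.
by rewrite mcoeffZ mcoeffX (negPf m'_m) mulr0.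
Qed.

Lemma in_box_coeff b p m :
  in_KZ b.2 p -> ('X_[b.1] * p : S)@_m != 0 -> in_box b m.
Proof.
move=> pZ; rewrite mcoeffXM; case: ifP => [le_bm p_m|]; last by rewrite eqxx.
apply/in_boxP; split=> // i ib; have := pZ _ p_m i ib.
by rewrite mnmBE; have /mnm_lepP/(_ i) := le_bm; lia.
Qed.

Lemma sdepth_ge_depth_tree gens k P :
    (forall f, in_ideal gens f <-> mon_ideal P f) ->
  depth_tree k P -> sdepth_ge gens k.
Proof.
move=> gensP /depth_tree_boxes[B geB countB].
pose b0 : 'X_{1..n} * {set 'I_n} := (0%MM, set0).
pose D := [seq ('X_[b.1] : S, b.2) | b <- B].
have sizeD : size D = size B by rewrite size_map.
have nthD i : (i < size B)%N ->
    nth (0%R : {mpoly K[n]}, set0) D i = ('X_[(nth b0 B i).1], (nth b0 B i).2).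
  by move=> ltiB; rewrite (nth_map b0).
have sum_box m : (\sum_(i < size B) in_box (nth b0 B i) m)%N = ~~ P m.
  rewrite -countB -sum1_count [RHS]big_mkcond [RHS](big_nth b0) [RHS]big_mkord.
  by apply: eq_bigr => i _; case: in_box.
have box_nP i m : (i < size B)%N -> in_box (nth b0 B i) m -> ~~ P m.
  move=> ltiB box_m; have := sum_box m; rewrite (bigD1 (Ordinal ltiB)) //= box_m.
  by case: (~~ P m).
exists D; split=> [|i]; last first.
  by rewrite sizeD => ltiB; rewrite nthD //; apply/geB/mem_nth.
rewrite /stanley_dec sizeD; split; [|split; [|split]].
- move=> i ltiB; by exists 1, (nth b0 B i).1; rewrite nthD // scale1r.
- move=> i ltiB p; rewrite nthD //= => pZ /gensP Pp; apply/mpolyP=> m; rewrite mcoeff0.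
  apply/eqP; apply: contraT => p_m.
  have Xp_m : ('X_[(nth b0 B i).1] * p : S)@_((nth b0 B i).1 + m) != 0.
    by rewrite mulrC mcoeffMX.
  by have := box_nP _ _ ltiB (in_box_coeff pZ Xp_m); rewrite Pp.
(* The part of [f] supported in the box [b], divided by ['X_[b.1]]. *)
- move=> f; pose p b : S := \sum_(m <- msupp f | in_box b m) f@_m *: 'X_[m - b.1].
  have pE b : 'X_[b.1] * p b = \sum_(m <- msupp f | in_box b m) f@_m *: 'X_[m].
    rewrite mulr_sumr; apply: eq_bigr => m /in_boxP[le_bm _].
    by rewrite -scalerAr -mpolyXD addmC submK.
  exists [seq p b | b <- B]; split; first by rewrite size_map.
  split=> [i ltiB m|].
    rewrite nthD // (nth_map b0) //=; move: (nth b0 B i) => b p_m j jb.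
    have : ('X_[b.1] * p b)@_(b.1 + m) != 0 by rewrite mulrC mcoeffMX.
    rewrite pE mcoeff_restrict; case: ifP => [/in_boxP[_ /(_ j jb)]|]; last by rewrite eqxx.
    by rewrite mnmDE; lia.
  apply/gensP => m; rewrite mcoeffB raddf_sum /=.
  (* Each monomial outside [P] is recovered exactly once, so the difference is supported in [P]. *)
  rewrite (eq_bigr (fun i : 'I_(size B) => f@_m *+ in_box (nth b0 B i) m)).
    by rewrite sumrMnr sum_box; case: (P m) => //=; rewrite subrr eqxx.
  move=> i _; rewrite nthD // (nth_map b0) //= pE mcoeff_restrict.
  by case: in_box.
- move=> ps _ psZ /gensP Pps i ltiB; apply/gensP => m u_m.
  have uZ j : (j < size B)%N -> (('X_[(nth b0 B j).1] * ps`_j : S)@_m != 0) ->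
      in_box (nth b0 B j) m.
    by move=> ltjB; apply: in_box_coeff; have := psZ j ltjB; rewrite nthD.
  rewrite nthD //= in u_m; have boxi := uZ i ltiB u_m.
  (* Boxes being disjoint, no other summand has a term at [m], so nothing cancels. *)
  apply: Pps; rewrite raddf_sum (bigD1 (Ordinal ltiB)) //= nthD //= big1 ?addr0 //.
  move=> j j_i; apply/eqP; apply: contraT; rewrite nthD //= => /(uZ _ (ltn_ord j)) boxj.
  have := sum_box m; rewrite (bigD1 (Ordinal ltiB)) // (bigD1 j) //= boxi boxj.
  by case: (~~ P m).
Qed.

End MonomialIdeals.


(** * Weakly regular sequences: extensions and permutation *)

Section RegularSequences.

Variables (K : fieldType) (n : nat).
Local Notation S := {mpoly K[n]}.
Local Open Scope ring_scope.
Implicit Types (J L Q : S -> Prop) (f g h x : S) (gens fs : seq S) (P : pred 'X_{1..n})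
  (A : {set 'I_n}) (m : 'X_{1..n}).

Definition ideal_add J f : S -> Prop := fun g => exists h, J (g - f * h).

Definition nonzerodiv J f := forall g, J (f * g) -> J g.

(** The quotient is allowed to vanish, so that the unit ideal is an admissible leaf; properness is
    checked only for the edge ideal itself. *)
Fixpoint weakly_regular J fs :=
  if fs is f :: fs' then nonzerodiv J f /\ weakly_regular (ideal_add J f) fs' else True.

Lemma ideal_add_ideal J f : ideal J -> ideal (ideal_add J f).
Proof.
move=> [J0 JD JM]; split=> [|g1 g2 [h1 J1] [h2 J2]|h g [h1 J1]].
- by exists 0; rewrite mulr0 subr0.
- exists (h1 + h2); rewrite (_ : _ - _ = (g1 - f * h1) + (g2 - f * h2)); last by ring.
  exact: JD.
- by exists (h * h1); rewrite (_ : _ - _ = h * (g - f * h1)); [exact: JM | ring].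
Qed.

Lemma sub_ideal_add J f g : J g -> ideal_add J f g.
Proof. by exists 0; rewrite mulr0 subr0. Qed.

Lemma ideal_add_self J f : ideal J -> ideal_add J f f.
Proof. by case=> J0 _ _; exists 1; rewrite mulr1 subrr. Qed.

Lemma ideal_addC J f x g : ideal_add (ideal_add J f) x g -> ideal_add (ideal_add J x) f g.
Proof. by case=> h1 [h2 Jg]; exists h2, h1; rewrite addrAC. Qed.

Lemma ideal_add_ext J L f : (forall g, J g <-> L g) ->
  forall g, ideal_add J f g <-> ideal_add L f g.
Proof. by move=> JL g; split=> -[h /JL]; exists h. Qed.

Lemma weakly_regular_ext J L fs : (forall g, J g <-> L g) ->
  weakly_regular J fs -> weakly_regular L fs.
Proof.
elim: fs J L => //= f fs IH J L JL [reg_f reg_fs]; split.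
  by move=> g /JL/reg_f/JL.
by apply: IH reg_fs; apply: ideal_add_ext.
Qed.

Lemma foldl_ideal_add_ideal J fs : ideal J -> ideal (foldl ideal_add J fs).
Proof. by elim: fs J => //= f fs IH J idJ; apply/IH/ideal_add_ideal. Qed.

Lemma sub_foldl_ideal_add J fs g : J g -> foldl ideal_add J fs g.
Proof. by elim: fs J => //= f fs IH J Jg; apply/IH/sub_ideal_add. Qed.

Lemma weakly_regular_rcons J fs f :
  weakly_regular J fs -> nonzerodiv (foldl ideal_add J fs) f ->
  weakly_regular J (rcons fs f).
Proof. by elim: fs J => //= f0 fs IH J [reg0 reg_fs] /IH H; split=> //; apply: H. Qed.

(* With [Q = (J : x)] and [L = J + (x)], this is the exact sequence
   [0 -> S/Q -> S/J -> S/L -> 0]: an element regular on both ends is regular in the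
   middle, and the sequence stays exact modulo that element. *)
Lemma weakly_regular_colon_plus J L Q x fs :
    ideal J -> (forall g, L g <-> ideal_add J x g) -> (forall g, Q g <-> J (x * g)) ->
  weakly_regular Q fs -> weakly_regular L fs -> weakly_regular J fs.
Proof.
elim: fs J L Q => //= f fs IH J L Q idJ LE QE [regQ reg_fsQ] [regL reg_fsL].
have [J0 JD JM] := idJ.
split.
  (* Regularity on [L] gives [g = x * h] modulo [J]; then [f * h] lies in [Q], hence [h] does. *)
  move=> g Jfg; have /regL/LE[h Jgh] : L (f * g) by apply/LE/sub_ideal_add.
  rewrite -(subrK (x * h) g); apply: JD => //; apply/QE/regQ/QE.
  rewrite (_ : x * (f * h) = f * g - f * (g - x * h)); last by ring.
  exact: idealB (JM _ _ _).
apply: (IH _ _ _ (ideal_add_ideal f idJ) _ _ reg_fsQ reg_fsL) => g.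
  split=> [/(ideal_add_ext f LE)|/ideal_addC/(ideal_add_ext f LE)] //.
  exact: ideal_addC.
split=> [[h /QE Jxgh]|[h Jxgh]].
  by exists (x * h); rewrite mulrCA -mulrBr.
(* Regularity of [f] on [L] makes [h] a multiple [x * h'] modulo [J], so that [x * (g - f * h')]
   lies in [J]. *)
have [h' Jhh'] : ideal_add J x h.
  apply/LE/regL/LE; exists g.
  by rewrite (_ : _ - _ = - 1 * (x * g - f * h)); [exact: JM | ring].
exists h'; apply/QE; rewrite (_ : _ * _ = (x * g - f * h) + f * (h - x * h')); last by ring.
by apply: JD => //; apply: JM.
Qed.

Definition graded J := forall d g, J g -> J (pihomog mdeg d g).

Lemma pihomogMl d e f g : f \is e.-homog ->
  pihomog mdeg d (f * g) = if (e <= d)%N then f * pihomog mdeg (d - e) g else 0.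
Proof.
move=> f_e; rewrite {1}(pihomog_partitionE (leqnn (mmeasure mdeg g))) mulr_sumr raddf_sum /=.
have homM i : f * pihomog mdeg i g \is (e + i).-homog by apply: dhomogM => //; apply: pihomogP.
have pihM i : pihomog mdeg d (f * pihomog mdeg i g) =
    if (e + i == d)%N then f * pihomog mdeg i g else 0.
  have [<-|ne] := eqVneq; first exact: pihomog_dE (homM i).
  exact: pihomog_ne0 ne (homM i).
under eq_bigr => i _ do rewrite pihM.
case: leqP => [le_ed|lt_de]; last first.
  by rewrite big1 // => i _; case: eqP => //; lia.
have [lt_g|ge_g] := ltnP (d - e)%N (mmeasure mdeg g).
  rewrite (bigD1 (Ordinal lt_g)) //= subnKC // eqxx big1 ?addr0 // => i i_ne.
  by case: eqP => // i_d; case/eqP: i_ne; apply: val_inj => /=; lia.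
rewrite big1 => [|[i /= lt_i] _]; last by case: eqP => //; lia.
suff -> : pihomog mdeg (d - e) g = 0 by rewrite mulr0.
rewrite pihomogE big_seq_cond big1 // => m /andP[mg /eqP md].
by have := mmeasure_mnm_lt mdeg mg; lia.
Qed.

Lemma graded_ideal_add J f e :
  ideal J -> graded J -> f \is e.-homog -> graded (ideal_add J f).
Proof.
move=> [J0 _ _] grJ f_e d g [h /(grJ d)]; rewrite raddfB /= (pihomogMl _ _ f_e).
by case: leqP => _; [exists (pihomog mdeg (d - e) h) | exists 0; rewrite mulr0].
Qed.

(* Regular sequences of homogeneous elements can be permuted: if [f g] lies in [J] then
   [g = a + x h] with [a] in [J] and [f h] in [J], where [h] has smaller degree. *)
Lemma nonzerodiv_graded J x f e :
    ideal J -> graded J -> x \is 1.-homog -> f \is e.-homog ->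
    nonzerodiv J x -> nonzerodiv (ideal_add J x) f ->
  nonzerodiv J f.
Proof.
move=> idJ grJ x_1 f_e regx regf g Jfg; have [J0 JD JM] := idJ.
suff homJ d h : J (f * pihomog mdeg d h) -> J (pihomog mdeg d h).
  rewrite (pihomog_partitionE (leqnn (mmeasure mdeg g))); apply: ideal_sum => // i _.
  by apply: homJ; have := grJ (e + i)%N _ Jfg; rewrite (pihomogMl _ _ f_e) leq_addr addKn.
(* A multiple of [x] has no component of degree 0, which settles the base case. *)
elim: d h => [|d IH] h Jfh; have [a] := regf _ (sub_ideal_add x Jfh).
  by move=> /(grJ 0%N); rewrite raddfB /= pihomog_id (pihomogMl _ _ x_1) subr0.
move=> /(grJ d.+1); rewrite raddfB /= pihomog_id (pihomogMl _ _ x_1) subn1 /= => Jha.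
rewrite -(subrK (x * pihomog mdeg d a) (pihomog mdeg d.+1 h)).
apply: JD => //; apply/JM/IH/regx.
rewrite (_ : x * _ = f * pihomog mdeg d.+1 h - f * (pihomog mdeg d.+1 h - x * pihomog mdeg d a)).
  exact: idealB (JM _ _ _).
by ring.
Qed.

Definition homogeneous_seq fs := forall f, f \in fs -> exists e, f \is e.-homog.

(** Moves [x] from the front of the sequence to its end, past one element [f] at a time: homogeneity
    makes [f] regular on [J], and regularity of [x] modulo [f] is then formal. *)
Lemma weakly_regular_swap J x fs :
    ideal J -> graded J -> x \is 1.-homog -> homogeneous_seq fs ->
    nonzerodiv J x -> weakly_regular (ideal_add J x) fs ->
  weakly_regular J fs /\ nonzerodiv (foldl ideal_add J fs) x.
Proof.
move=> + + x_1; elim: fs J => //= f fs IH J idJ grJ hom_fs regx [regf reg_fs].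
have [J0 JD JM] := idJ.
have [e f_e] : exists e, f \is e.-homog by apply: hom_fs; rewrite mem_head.
have regJf := nonzerodiv_graded idJ grJ x_1 f_e regx regf.
have [] // := IH (ideal_add J f).
- exact: ideal_add_ideal.
- exact: graded_ideal_add f_e.
- by move=> f' f'_fs; apply: hom_fs; rewrite inE f'_fs orbT.
- move=> g [h Jxgh]; have [h' Jhh'] : ideal_add J x h.
    apply: regf; exists g.
    by rewrite (_ : _ - _ = - 1 * (x * g - f * h)); [exact: JM | ring].
  exists h'; apply: regx.
  rewrite (_ : _ * _ = (x * g - f * h) + f * (h - x * h')); last by ring.
  by apply: JD => //; apply: JM.
- by apply: weakly_regular_ext reg_fs => g; split; apply: ideal_addC.
Qed.

(** * Ideals of variables and elementary symmetric polynomials *)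

Definition vars_pred A : pred 'X_{1..n} := fun m => [exists i in A, 0 < m i]%N.

Lemma vars_pred_up A : up_closed (vars_pred A).
Proof.
move=> m m' /exists_inP[i iA mi]; apply/exists_inP; exists i => //.
by rewrite mnmDE addn_gt0 mi.
Qed.

Lemma graded_mon_ideal P : graded (mon_ideal P).
Proof.
by move=> d g Pg m; rewrite mcoeff_restrict; case: ifP => [_ /Pg|]; rewrite ?eqxx.
Qed.

Lemma mon_ideal_add_var P (P' : pred 'X_{1..n}) i :
    (forall m, P' m = P m || (0 < m i)%N) ->
  forall g, mon_ideal P' g <-> ideal_add (mon_ideal P) 'X_i g.
Proof.
move=> P'E g; split=> [P'g|[h Pgh] m g_m].
  (* The terms of [g] divisible by ['X_i], divided by it. *)
  exists (\sum_(m <- msupp g | (0 < m i)%N) g@_m *: 'X_[m - U_(i)]) => m.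
  rewrite mulr_sumr (eq_bigr (fun m' => g@_m' *: 'X_[m'])) => [|m' mi].
    rewrite mcoeffB mcoeff_restrict; case: ifP => mi; first by rewrite subrr eqxx.
    by rewrite subr0 => /P'g; rewrite P'E => /orP[//|]; rewrite mi.
  by rewrite -scalerAr -mpolyXD addmC submK // lep1mP -lt0n.
rewrite P'E; apply/orP; have [mi|] := posnP (m i); [left; apply: Pgh | by right].
by rewrite mcoeffB mcoeffXM lep1mP mi eqxx subr0.
Qed.

Lemma mon_ideal_colon_var P (P' : pred 'X_{1..n}) i :
    (forall m, P' m = P (m + U_(i))%MM) ->
  forall g, mon_ideal P' g <-> mon_ideal P ('X_i * g).
Proof.
move=> P'E g; split=> [P'g m|Pg m g_m].
  by rewrite mcoeffXM; case: ifP => [le_im /P'g|]; rewrite ?P'E ?submK // eqxx.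
by rewrite P'E; apply: Pg; rewrite addmC mulrC mcoeffMX.
Qed.

Lemma nonzerodiv_var A i : i \notin A -> nonzerodiv (mon_ideal (vars_pred A)) 'X_i.
Proof.
move=> iA g Xg m g_m; have /exists_inP[u uA] : vars_pred A (U_(i) + m)%MM.
  by apply: Xg; rewrite mulrC mcoeffMX.
have /negPf i_u : i != u by apply: contraNneq iA => ->.
by rewrite mnmDE mnm1E i_u => mu; apply/exists_inP; exists u.
Qed.

(** The shift skips the symmetric polynomial of degree 0, which is 1. *)
Definition mesyms k : seq S := [seq mesym n K j.+1 | j <- iota 0 k].

Lemma mesym_homog j : mesym n K j \is j.-homog.
Proof.
by rewrite mesymE; apply: rpred_sum => h /eqP<-; rewrite dhomogX; apply/eqP/mdeg_mesym1.
Qed.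

Lemma nonzerodiv_prod J (I : Type) (r : seq I) (Q : pred I) (F : I -> S) :
  (forall i, Q i -> nonzerodiv J (F i)) -> nonzerodiv J (\prod_(i <- r | Q i) F i).
Proof.
move=> regF; apply: (big_ind (nonzerodiv J)) => // [g|f1 f2 reg1 reg2 g].
  by rewrite mul1r.
by rewrite -mulrA => /reg1/reg2.
Qed.

(* Modulo the variables in [A], the symmetric function of degree [n - #|A|] is the
   product of the remaining variables. *)
Lemma mesym_mod_vars A :
  mon_ideal (vars_pred A) (mesym n K (n - #|A|) - \prod_(i in ~: A) 'X_i).
Proof.
have cardCA : #|~: A| = (n - #|A|)%N by rewrite cardsCs setCK card_ord.
rewrite /mesym (bigD1 (~: A)) ?cardCA //= addrC addrK.
have idA := mon_ideal_ideal K (@vars_pred_up A).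
apply: ideal_sum => // B /andP[/eqP cardB B_CA].
(* Any other set of this size meets [A], so its monomial lies in the ideal. *)
have [i iB iA] : exists2 i, i \in B & i \in A.
  have /subsetPn[i iB] : ~~ (B \subset ~: A).
    by apply: contra B_CA => sBA; rewrite eqEcard sBA cardB cardCA leqnn.
  by rewrite inE negbK; exists i.
rewrite (bigD1 i) //= mulrC; case: idA => _ _; apply => m.
rewrite mcoeffX; have [<- _|_] := eqVneq U_(i)%MM m; last by rewrite eqxx.
by apply/exists_inP; exists i; rewrite // mnm1E eqxx.
Qed.

(** Induction on the number of variables outside [A]: while [k + #|A| < n] one more variable can be
    adjoined to [A] and moved past the sequence; at equality only the last element needs a separate
    argument. *)
Lemma mesyms_weakly_regular A k : (k + #|A| <= n)%N ->
  weakly_regular (mon_ideal (vars_pred A)) (mesyms k).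
Proof.
have [N] := ubnP (n - #|A|); elim: N A k => // N IH A k; rewrite ltnS => leN leA.
have idA := mon_ideal_ideal K (@vars_pred_up A).
have hom_mesyms j : homogeneous_seq (mesyms j).
  by move=> _ /mapP[d _ ->]; exists d.+1; apply: mesym_homog.
(* The sequence is regular once ['X_i] is adjoined to the ideal, by induction; moving ['X_i] to the
   end gives both claims. *)
have step i j : i \notin A -> (j + #|A| < n)%N ->
    weakly_regular (mon_ideal (vars_pred A)) (mesyms j) /\
    nonzerodiv (foldl ideal_add (mon_ideal (vars_pred A)) (mesyms j)) 'X_i.
  move=> iA lt_jA; apply: weakly_regular_swap => //.
  - exact: graded_mon_ideal.
  - by rewrite dhomogX; apply/eqP/mdeg1.
  - exact: nonzerodiv_var.
  apply: (@weakly_regular_ext (mon_ideal (vars_pred (i |: A)))).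
    apply: mon_ideal_add_var => m; apply/exists_inP/orP.
      case=> u /setU1P[->|uA] mu; first by right.
      by left; apply/exists_inP; exists u.
    case=> [/exists_inP[u uA mu]|mi]; last by exists i; rewrite ?setU11.
    by exists u; rewrite // inE uA orbT.
  by apply: IH; rewrite cardsU1 iA; lia.
case: k leA => // k leA.
have [i iA] : exists i, i \notin A.
  have /subsetPn[i _ iA] : ~~ ([set: 'I_n] \subset A); last by exists i.
  by apply: contraL leA => /subset_leq_card; rewrite cardsT card_ord; lia.
have [lt_kA|ge_kA] := ltnP (k.+1 + #|A|) n; first by have [] := step i k.+1 iA lt_kA.
have k_eq : k.+1 = (n - #|A|)%N by lia.
have mesyms_rcons : mesyms k.+1 = rcons (mesyms k) (mesym n K k.+1).
  by rewrite /mesyms -addn1 iotaD map_cat /= add0n cats1 addn1.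
(* The last element is congruent to the product of the variables outside [A], each of which is
   regular modulo the earlier elements by [step]. *)
rewrite mesyms_rcons; apply: weakly_regular_rcons; first by have [] := step i k iA leA.
have idAk := foldl_ideal_add_ideal (mesyms k) idA.
move=> g Jg; have := @nonzerodiv_prod (foldl ideal_add (mon_ideal (vars_pred A)) (mesyms k))
  _ (index_enum _) [in ~: A] (fun j => 'X_j); apply=> [j|].
  by rewrite inE => jA; have [] := step j k jA leA.
set p := \prod_(_ <- _ | _) _.
rewrite (_ : p * g = mesym n K k.+1 * g - g * (mesym n K k.+1 - p)); last by ring.
apply: idealB => //; case: idAk => _ _; apply; apply: sub_foldl_ideal_add.
by rewrite k_eq; apply: mesym_mod_vars.
Qed.

(** * From trees to depth *)

Lemma weakly_regular_unit J fs : (forall g, J g) -> weakly_regular J fs.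
Proof.
elim: fs J => //= f fs IH J JT; split=> [g _|]; first exact: JT.
by apply: IH => g; apply: sub_ideal_add.
Qed.

Lemma depth_tree_weakly_regular k P :
  up_closed P -> depth_tree k P -> weakly_regular (mon_ideal P) (mesyms k).
Proof.
move=> + treeP; elim: treeP => {P} [P PT|P A PA leA|P Pc Pp i PcE PpE _ IHc _ IHp] upP.
- by apply: weakly_regular_unit => g m.
- apply: weakly_regular_ext (mesyms_weakly_regular leA) => g.
  by split=> Pg m /Pg; rewrite PA.
apply: (weakly_regular_colon_plus (mon_ideal_ideal K upP)
  (mon_ideal_add_var PpE) (mon_ideal_colon_var PcE)).
  by apply: IHc => m m'; rewrite !PcE -addmA [(m' + _)%MM]addmC addmA; apply: upP.
apply: IHp => m m'; rewrite !PpE mnmDE addn_gt0 => /orP[/(upP m m')->//|->].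
by rewrite orbT.
Qed.

Lemma in_ideal_rcons gens f g :
  ideal_add (in_ideal gens) f g <-> in_ideal (rcons gens f) g.
Proof.
have idJ := in_ideal_ideal (rcons gens f); have [_ JD JM] := idJ.
split=> [[h gens_gh]|].
  rewrite -(subrK (f * h) g); apply: JD; last first.
    by rewrite mulrC; apply/JM/in_ideal_gen; rewrite mem_rcons mem_head.
  apply: in_ideal_min gens_gh => // f' f'_gens; apply: in_ideal_gen.
  by rewrite mem_rcons inE f'_gens orbT.
apply: in_ideal_min; first exact/ideal_add_ideal/in_ideal_ideal.
move=> f'; rewrite mem_rcons inE => /predU1P[->|/in_ideal_gen].
  exact/ideal_add_self/in_ideal_ideal.
exact: sub_ideal_add.
Qed.

Lemma weakly_regular_take gens fs : weakly_regular (in_ideal gens) fs ->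
  forall j, (j < size fs)%N -> nonzerodiv (in_ideal (gens ++ take j fs)) fs`_j.
Proof.
elim: fs gens => //= f fs IH gens [regf reg_fs] [_|j lt_j] /=.
  by rewrite cats0.
rewrite -cat_rcons; apply: IH lt_j.
exact: weakly_regular_ext (in_ideal_rcons gens f) reg_fs.
Qed.

(** Excluding [set0] makes the final ideal proper: all edge monomials and all elements of the
    sequence have constant term zero. *)
Lemma depth_ge_depth_tree (E : {set {set 'I_n}}) k :
  set0 \notin E -> depth_tree k (mon_in E) -> depth_ge (edge_gens K E) k.
Proof.
move=> E0 treeE; have sz : size (mesyms k) = k by rewrite size_map size_iota.
have mesyms0 f : f \in mesyms k -> in_max_ideal f.
  case/mapP=> j _ ->; apply: dhomog_nemf_coeff (mesym_homog j.+1) _.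
  by rewrite /= mdeg0.
exists (mesyms k); split=> //; split; [|split].
- by move=> j lt_j; apply/mesyms0/mem_nth.
- apply: weakly_regular_take.
  apply: weakly_regular_ext (depth_tree_weakly_regular (@mon_in_up _ E) treeE) => g.
  by split=> /in_ideal_edges.
move=> unit; suff : in_max_ideal (1 : S) by apply/eqP; rewrite mcoeff1 eqxx oner_neq0.
apply: in_ideal_min unit => [|f].
  split=> [|f g f0 g0|h f f0]; rewrite /in_max_ideal ?mcoeff0 ?mcoeffD ?f0 ?g0 ?addr0 //.
  by rewrite rmorphM /= [X in _ * X]f0 mulr0.
rewrite mem_cat => /orP[/in_ideal_gen/in_ideal_edges Ef|/mesyms0//].
apply/eqP; apply: contraT => /Ef/mon_inP[e eE e0]; case/negP: E0.
suff <- : e = set0 by [].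
by apply/setP=> i; rewrite inE; apply/negP => /e0; rewrite mnm0E.
Qed.

End RegularSequences.

Theorem theorem3p7 (K : fieldType) (n : nat)
    (V : {set 'I_n}) (E : {set {set 'I_n}}) :
  clutter V E ->
  depth_ge (edge_gens K E) (eps E + n - #|Vred E|) /\
  sdepth_ge (edge_gens K E) (eps E + n - #|Vred E|).
Proof.
case=> _ [E_n0 _]; have tree := depth_tree_edges E; split.
  by apply: depth_ge_depth_tree tree; apply/negP => /E_n0; rewrite eqxx.
exact: sdepth_ge_depth_tree (@in_ideal_edges K n E) tree.
Qed.
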